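(* Let $G$ be a unicyclic graph of order $n\ge 5$ not isomorphic to the cycle $C_n$. Then $\operatorname{CS}(G,x)\preceq\operatorname{CS}(U_n,x)$.
   Context: All graphs are finite, simple and undirected. A unicyclic graph is a connected graph $G$ with $|V(G)|=|E(G)|$. $U_n=(K_2\cup\overline{K_{n-3}})\vee K_1$ (a triangle $cab$ with $n-3$ pendant leaves attached at $c$). A connected set of $G$ is a subset of $V(G)$ inducing a connected subgraph; $S_k(G)$ is the number of connected sets of size $k$, and $\operatorname{CS}(G,x)=\sum_{k=1}^{n}S_k(G)x^k$. For polynomials $A(x)=\sum_{k=0}^n a_kx^k$, $B(x)=\sum_{k=0}^m b_kx^k$, write $B(x)\preceq A(x)$ if $m\le n$ and $b_k\le a_k$ for all $k$. *)

(* Defs.v *)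
From HB Require Import structures.
From mathcomp Require Import all_boot all_order all_algebra.

Set Implicit Arguments.
Unset Strict Implicit.
Unset Printing Implicit Defensive.

Import Order.TTheory GRing.Theory Num.Theory.

Record sgraph := SGraph {
  vertex :> finType;
  adj : rel vertex;
  adj_sym : symmetric adj;
  adj_irrefl : irreflexive adj }.

Definition edges (G : sgraph) : {set {set G}} :=
  [set [set p.1; p.2] | p : G * G & adj p.1 p.2].

Definition isomorphic (G H : sgraph) : Prop :=
  exists2 f : G -> H, bijective f & forall x y, adj (f x) (f y) = adj x y.

(* The graph without vertices is not connected. *)
Definition connected_graph (G : sgraph) : bool :=
  (0 < #|G|) && [forall x : G, forall y : G, connect (@adj G) x y].

Definition unicyclic (G : sgraph) : bool :=
  connected_graph G && (#|G| == #|edges G|).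

Section Induced.
Variables (G : sgraph) (A : {set G}).

Definition induced_adj : rel {x : G | x \in A} :=
  fun x y => adj (val x) (val y).

Lemma induced_sym : symmetric induced_adj.
Proof. by move=> x y; apply: adj_sym. Qed.

Lemma induced_irrefl : irreflexive induced_adj.
Proof. by move=> x; apply: adj_irrefl. Qed.

Definition induced : sgraph := SGraph induced_sym induced_irrefl.
End Induced.

Definition connected_set (G : sgraph) (A : {set G}) : bool :=
  connected_graph (induced A).

Definition nb_connected_sets (G : sgraph) (k : nat) : nat :=
  #|[set A : {set G} | connected_set A & #|A| == k]|.

Definition CS (G : sgraph) : {poly int} :=
  (\sum_(1 <= k < #|G|.+1) (nb_connected_sets G k)%:R *: 'X^k)%R.

(* [size p] is the degree of [p] plus one, so the first conjunct compares the
   degrees (the zero polynomial having the least one). *)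
Definition poly_preceq (R : numDomainType) (q p : {poly R}) : Prop :=
  size q <= size p /\ forall k : nat, (q`_k <= p`_k)%R.

Definition complete_adj (n : nat) : rel 'I_n := fun i j => i != j.

Lemma complete_sym n : symmetric (@complete_adj n).
Proof. by move=> i j; rewrite /complete_adj eq_sym. Qed.

Lemma complete_irrefl n : irreflexive (@complete_adj n).
Proof. by move=> i; rewrite /complete_adj eqxx. Qed.

Definition complete (n : nat) : sgraph :=
  SGraph (@complete_sym n) (@complete_irrefl n).

Section Complement.
Variable G : sgraph.

Definition compl_adj : rel G := fun x y => (x != y) && ~~ adj x y.

Lemma compl_sym : symmetric compl_adj.
Proof. by move=> x y; rewrite /compl_adj eq_sym adj_sym. Qed.

Lemma compl_irrefl : irreflexive compl_adj.
Proof. by move=> x; rewrite /compl_adj eqxx. Qed.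

Definition complement : sgraph := SGraph compl_sym compl_irrefl.
End Complement.

Section UnionJoin.
Variables G H : sgraph.

(* [b] tells whether vertices of different sides are adjacent: [false] gives
   the disjoint union, [true] the join. *)
Definition sum_adj (b : bool) : rel (G + H)%type := fun u v =>
  match u, v with
  | inl x, inl y => adj x y
  | inr x, inr y => adj x y
  | _, _ => b
  end.

Lemma sum_sym b : symmetric (sum_adj b).
Proof. by case=> x [] y //=; apply: adj_sym. Qed.

Lemma sum_irrefl b : irreflexive (sum_adj b).
Proof. by case=> x /=; apply: adj_irrefl. Qed.

Definition disjoint_union : sgraph :=
  SGraph (@sum_sym false) (@sum_irrefl false).

Definition join : sgraph := SGraph (@sum_sym true) (@sum_irrefl true).
End UnionJoin.

(* The cycle on n vertices when n >= 3; [i != j] only matters when n = 1. *)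
Definition cycle_adj (n : nat) : rel 'I_n :=
  fun i j => (i != j) && ((j == ordS i) || (i == ordS j)).

Lemma cycle_sym n : symmetric (@cycle_adj n).
Proof. by move=> i j; rewrite /cycle_adj eq_sym orbC. Qed.

Lemma cycle_irrefl n : irreflexive (@cycle_adj n).
Proof. by move=> i; rewrite /cycle_adj eqxx. Qed.

Definition cycle_graph (n : nat) : sgraph :=
  SGraph (@cycle_sym n) (@cycle_irrefl n).

(* Meaningful for n >= 3, since [n - 3] is truncated. *)
Definition U (n : nat) : sgraph :=
  join (disjoint_union (complete 2) (complement (complete (n - 3))))
       (complete 1).

(* Main.v *)
Require Import Defs.
From mathcomp Require Import all_boot all_order all_algebra.
From mathcomp Require Import zify.

(* For k >= 3 the graph U_n has at least C(n-1, k-1) connected k-sets, since its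
   centre is adjacent to every vertex. Conversely, S_k(G) <= C(n-1, k-1) for a
   unicyclic G, unless G is a cycle and k = n-1, by induction on n. On a cycle
   S_k <= n <= C(n-1, k-1) for k <= n-2. Otherwise G has a leaf v with neighbour
   w; the connected k-sets avoiding v are counted by induction in G - v, and
   those containing v contain w, so they number at most C(n-2, k-2). When G - v
   is a cycle and k = n-2, the first bound is off by one, but not every k-set
   containing v and w is connected. *)

Set Implicit Arguments.
Unset Strict Implicit.
Unset Printing Implicit Defensive.

Import GRing.Theory Num.Theory.

(** * Degrees, and connectivity by closed subsets *)

Definition neighbours (G : sgraph) (x : G) : {set G} := [set y | adj x y].

Definition degree (G : sgraph) (x : G) : nat := #|neighbours x|.

Definition two_regular (G : sgraph) : bool := [forall x : G, degree x == 2].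

Lemma in_neighbours (G : sgraph) (x y : G) : (y \in neighbours x) = adj x y.
Proof. by rewrite inE. Qed.

(** For [S] inside [A]: a union of components of the subgraph induced on [A]. Connectivity is used
    below as the absence of a proper nonempty such [S], which avoids reasoning about [connect] on a
    subtype. *)
Definition adj_closed (G : sgraph) (A S : {set G}) : Prop :=
  forall x y, x \in S -> y \in A -> adj x y -> y \in S.

Lemma connected_graphP (G : sgraph) :
  reflect (0 < #|G| /\ forall S : {set G}, S != set0 ->
             adj_closed [set: G] S -> S = [set: G])
          (connected_graph G).
Proof.
have sym : connect_sym (@adj G) := sym_connect_sym (@adj_sym G).
apply: (iffP andP) => [[G_gt0 /forallP conn]|[G_gt0 closedT]]; split=> //.
  move=> S /set0Pn [x xS] Scl; apply/setP=> y; rewrite inE.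
  have /forallP/(_ y) xy := conn x.
  have S_closed : closed (@adj G) S.
    by apply: intro_closed => // u v uv uS; apply: Scl uS _ uv; rewrite inE.
  by rewrite -(closed_connect S_closed xy).
apply/forallP=> x; apply/forallP=> y.
have := closedT [set z | connect (@adj G) x z].
case/(_ _ _)/Wrap => [||/setP/(_ y)]; last by rewrite !inE.
  by apply/set0Pn; exists x; rewrite inE connect0.
move=> u v; rewrite !inE => xu _ uv.
exact: connect_trans xu (connect1 uv).
Qed.

Lemma connected_setP (G : sgraph) (A : {set G}) :
  reflect (A != set0 /\ forall S : {set G}, S \subset A -> S != set0 ->
             adj_closed A S -> S = A)
          (connected_set A).
Proof.
have cardA : #|induced A| = #|A| by rewrite card_sig; apply: eq_card.
apply: (iffP (connected_graphP _)) => -[A_gt0 closedT].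
  split=> [|S SA /set0Pn [x xS] Scl]; first by rewrite -card_gt0 -cardA.
  have xA := subsetP SA x xS.
  have := closedT [set z | val z \in S].
  case/(_ _ _)/Wrap => [||/setP eqT].
  - by apply/set0Pn; exists (Sub x xA); rewrite inE.
  - by move=> u v; rewrite !inE => uS _ uv; apply: Scl uS (valP v) uv.
  apply/eqP; rewrite eqEsubset SA; apply/subsetP=> y yA.
  by have := eqT (Sub y yA); rewrite !inE.
split=> [|S S_n0 Scl]; first by rewrite cardA card_gt0.
have memS (z : induced A) : (val z \in val @: S) = (z \in S).
  by rewrite mem_imset //; apply: val_inj.
have := closedT (val @: S).
case/(_ _ _ _)/Wrap => [|||/setP eqA].
- by apply/subsetP=> _ /imsetP [z _ ->]; apply: valP.
- by case/set0Pn: S_n0 => z zS; apply/set0Pn; exists (val z); rewrite memS.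
- move=> _ y /imsetP [u uS ->] yA uy.
  have -> : y = val (Sub y yA : induced A) by [].
  by rewrite memS; apply: (Scl u) => //; rewrite inE.
by apply/setP=> z; rewrite -memS eqA inE; apply: valP.
Qed.

Lemma connected_setT (G : sgraph) :
  connected_graph G = connected_set [set: G].
Proof.
apply/connected_graphP/connected_setP => -[G_n0 closedT]; split.
- by rewrite -card_gt0 cardsT.
- by move=> S _; apply: closedT.
- by rewrite -cardsT card_gt0.
- by move=> S; apply: closedT; apply: subsetT.
Qed.

(** Count the ordered adjacent pairs twice: by first component, and by underlying edge, where every
    fibre has two elements as there are no loops. *)
Lemma handshake (G : sgraph) : \sum_(x : G) degree x = 2 * #|edges G|.
Proof.
pose D := [set p : G * G | adj p.1 p.2].
have -> : \sum_(x : G) degree x = #|D|.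
  rewrite -sum1_card (eq_bigl (fun p => adj p.1 p.2)); last by move=> p; rewrite inE.
  rewrite -(pair_big_dep xpredT (fun x y : G => adj x y) (fun _ _ => 1)) /=.
  by apply: eq_bigr => x _; rewrite sum1_card /degree; apply: eq_card => y; rewrite inE.
rewrite -sum1_card (partition_big_imset (fun p : G * G => [set p.1; p.2])) /=.
have -> : [set [set p.1; p.2] | p in D] = edges G.
  apply/setP=> e; apply/imsetP/imsetP=> -[p pD ->]; exists p => //; by move: pD; rewrite !inE.
rewrite mulnC -sum_nat_const; apply: eq_bigr => _ /imsetP [[a b] /= ab ->].
have <- : #|[set (a, b); (b, a)]| = 2.
  rewrite cards2 xpair_eqE; case: eqVneq => //= e.
  by move: ab; rewrite inE /= e adj_irrefl.
rewrite sum1dep_card; apply: eq_card => -[c d]; rewrite !inE /= !xpair_eqE.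
apply/andP/orP.
  case=> cd /eqP/setP eq_ab.
  have := eq_ab c; have := eq_ab d; rewrite !inE !eqxx !orbT /=.
  move=> /esym/orP [] /eqP d_ab /esym/orP [] /eqP c_ab;
    rewrite d_ab c_ab ?adj_irrefl // in cd *; rewrite !eqxx; auto.
by rewrite inE /= in ab; case=> /andP [/eqP -> /eqP ->]; rewrite ?(adj_sym b) // setUC.
Qed.

(** * Connected 2-regular graphs are cycles *)

Lemma neighbours_two_regular (G : sgraph) (x y z : G) :
  two_regular G -> adj x y -> adj x z -> y != z -> neighbours x = [set y; z].
Proof.
move=> /forallP/(_ x)/eqP deg_x xy xz yz; apply/esym/eqP.
rewrite eqEcard -/(degree x) deg_x cards2 yz andbT.
by apply/subsetP=> t; rewrite !inE => /orP [] /eqP ->.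
Qed.

(** The images of the predecessor and the successor of [i] use up the degree of [g i]. So the image
    of [g] is closed under adjacency, hence everything, and [g] creates no further adjacency. *)
Lemma ordS_adjacent_isomorphic (G : sgraph) (n : nat) (g : 'I_n -> G) :
  2 < n -> connected_graph G -> two_regular G -> injective g ->
  (forall i, adj (g i) (g (ordS i))) -> isomorphic G (cycle_graph n).
Proof.
move=> n_gt2 connG reg g_inj g_adj.
have nbr i : neighbours (g i) = [set g (ordS i); g (ord_pred i)].
  apply: neighbours_two_regular => //.
    by rewrite adj_sym -{2}[i]ord_predK.
  (* Successor and predecessor of [i] differ: i + 2 is not i modulo n, since n > 2. The cases follow
     the wrap-around. *)
  rewrite inj_eq // -(inj_eq (@ordS_inj _)) ord_predK -val_eqE /=.
  have := ltn_ord i; case: (i.+1 =P n) => [e|ne] lt_in.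
    rewrite e modnn modn_small; last lia.
    by apply/eqP; lia.
  rewrite (@modn_small i.+1); last lia.
  case: (i.+2 =P n) => [e|ne2]; first by rewrite e modnn; apply/eqP; lia.
  rewrite modn_small; last lia.
  by apply/eqP; lia.
have g_onto : [set g i | i : 'I_n] = [set: G].
  case/connected_graphP: connG => _; apply.
    by apply/set0Pn; exists (g (Ordinal n_gt2)); apply: imset_f.
  move=> _ y /imsetP [i _ ->] _; rewrite -in_neighbours nbr !inE.
  by case/orP => /eqP ->; apply: imset_f.
have [h gK hK] : bijective g.
  by apply: inj_card_bij => //; rewrite -cardsT -g_onto leq_imset_card.
exists h => [|x y]; first by exists g.
rewrite -{2}[x]hK -{2}[y]hK -[RHS]in_neighbours nbr !inE !(inj_eq g_inj) /= /cycle_adj.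
rewrite -[h y == ord_pred _](inj_eq (@ordS_inj _)) ord_predK [_ == ordS (h y)]eq_sym.
rewrite andb_idl // [ordS (h y) == _]eq_sym; apply: contraTneq => <-; rewrite orbb.
by apply: contraFN (adj_irrefl (g (h x))) => /eqP e; rewrite {2}e.
Qed.

(* Take a simple path of maximal length. All neighbours of its last vertex lie
   on it, and inner vertices have no spare neighbour, so it closes up. *)
Lemma two_regular_isomorphic_cycle (G : sgraph) :
  connected_graph G -> two_regular G -> isomorphic G (cycle_graph #|G|).
Proof.
move=> connG reg.
have /card_gt0P [x0 _] : 0 < #|G| by case/connected_graphP: connG.
pose P n := [exists t : n.-tuple G, uniq t && sorted (@adj G) t].
have P1 : exists n, P n by exists 1; apply/existsP; exists [tuple x0].
have P_le n : P n -> n <= #|G|.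
  by case/existsP=> t /andP [/card_uniqP t_uniq _]; rewrite -(size_tuple t) -t_uniq max_card.
case: (ex_maxnP P1 P_le) => m /existsP [[t sz] /= /andP [t_uniq t_sorted]] m_max.
move/eqP in sz.
have m_gt0 : 0 < m by apply: m_max; apply/existsP; exists [tuple x0].
pose s i := nth x0 t i.
have s_inj i j : i < m -> j < m -> s i = s j -> i = j.
  by move=> im jm /eqP; rewrite nth_uniq ?sz // => /eqP.
have s_adj i : i.+1 < m -> adj (s i) (s i.+1).
  by move=> im; apply: (sortedP x0 t_sorted); rewrite sz.
have last_adj y : adj (s m.-1) y -> exists2 i, i < m & y = s i.
  move=> zy; have [yt|yNt] := boolP (y \in t).
    exists (index y t); first by rewrite -sz index_mem.
    by rewrite /s nth_index.
  suff /m_max : P m.+1 by rewrite ltnn.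
  have szr : size (rcons t y) == m.+1 by rewrite size_rcons sz.
  apply/existsP; exists (Tuple szr); rewrite /= rcons_uniq yNt t_uniq /=.
  move: t_sorted m_gt0 zy; rewrite /s -sz.
  case: (t) => [|a u] //= u_path _ zy.
  by rewrite rcons_path u_path /= (last_nth x0).
(* Of the two neighbours of the last vertex, one differs from the vertex before it on the path. *)
have [y [zy yNs]] : exists y, adj (s m.-1) y /\ y != s m.-2.
  have /cards2P [a [b [ab eq_ab]]] := forallP reg (s m.-1).
  have ha : adj (s m.-1) a by rewrite -in_neighbours eq_ab !inE eqxx.
  have hb : adj (s m.-1) b by rewrite -in_neighbours eq_ab !inE eqxx orbT.
  by case: (eqVneq a (s m.-2)) => [e|ne]; [exists b; rewrite -e eq_sym | exists a].
have [i im ey] := last_adj y zy; rewrite {y}ey in zy yNs.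
have i1 : i != m.-1 by apply: contraTneq zy => ->; rewrite adj_irrefl.
have i2 : i != m.-2 by apply: contraNneq yNs => ->.
have i0 : i = 0.
  case: i => // i in im zy yNs i1 i2 *.
  have := @neighbours_two_regular G (s i.+1) (s i) (s i.+2) reg.
  case/(_ _ _ _)/Wrap => [|||/setP/(_ (s m.-1))].
  - by rewrite adj_sym s_adj.
  - by apply: s_adj; lia.
  - by apply/eqP=> /s_inj; lia.
  rewrite !inE adj_sym zy => /esym/orP [] /eqP /s_inj; lia.
subst i.
have iso : isomorphic G (cycle_graph m).
  (* Here m > 2, because [i], now 0, is neither m - 1 nor m - 2. *)
  apply: (@ordS_adjacent_isomorphic G m (fun i => s i)) => //; first lia.
    by move=> i j /s_inj e; apply/val_inj/e.
  move=> i /=; have := ltn_ord i; case: (i.+1 =P m) => [e|ne] lt_im.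
    by rewrite e modnn; have -> : nat_of_ord i = m.-1 by lia.
  by rewrite modn_small ?s_adj //; lia.
have [f f_bij _] := iso.
by have -> : #|G| = m by rewrite (bij_eq_card f_bij) card_ord.
Qed.

(** * Connected sets of a cycle *)

(** The arguments on arcs use a cycle only through its rotation [f] by one step and the inverse
    rotation [g], transported to [G]. *)
Lemma cycle_isomorphic_shift (G : sgraph) (n : nat) :
  isomorphic G (cycle_graph n) -> exists f g : G -> G,
    [/\ cancel f g, cancel g f &
        forall x y, adj x y -> y = f x \/ y = g x].
Proof.
case=> h [k hK kK] h_adj.
exists (k \o @ordS n \o h), (k \o @ord_pred n \o h); split=> [x|x|x y] /=.
- by rewrite kK ordSK hK.
- by rewrite kK ord_predK hK.
rewrite -h_adj /= /cycle_adj => /andP [_ /orP [] /eqP e].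
  by left; rewrite -e hK.
by right; rewrite e ordSK hK.
Qed.

(* Walk from [x] along [f] until leaving [A] or [B]: the vertices met form a
   closed part of the set that was left first, hence all of it. *)
Lemma connected_arcs_eq (G : sgraph) (f g : G -> G) (A B : {set G}) (x : G) :
  cancel f g -> cancel g f -> (forall x y, adj x y -> y = f x \/ y = g x) ->
  connected_set A -> connected_set B -> #|A| = #|B| ->
  x \in A -> x \in B -> g x \notin A -> g x \notin B -> A = B.
Proof.
move=> fK gK adj_fg cA cB cAB xA xB gA gB.
have exit_gx : exists j, (iter j f x \notin A) || (iter j f x \notin B).
  (* The walk does leave [A]: it returns to [x] after [order f x] steps, and one step earlier it is
     at [g x]. *)
  exists (order f x).-1; rewrite -/(finv f x).
  have -> : finv f x = g x by rewrite -{1}[x]gK finv_f //; apply: can_inj fK.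
  by rewrite gA.
have [j j_exit j_min] := ex_minnP exit_gx.
have arc_eq (C : {set G}) : connected_set C -> x \in C -> g x \notin C ->
    iter j f x \notin C -> (forall i, i < j -> iter i f x \in C) ->
    C = [set iter (i : 'I_j) f x | i : 'I_j].
  case/connected_setP=> _ closedT xC gxC jC arcC.
  have j_gt0 : 0 < j by case: (j) jC => //=; rewrite xC.
  apply/esym/closedT; first by apply/subsetP=> _ /imsetP [i _ ->]; apply: arcC.
    by apply/set0Pn; exists x; apply/imsetP; exists (Ordinal j_gt0).
  (* The arc cannot be left inside [C]: past its end lies the exit vertex and before its start lies
     [g x], both outside [C]. *)
  move=> _ y /imsetP [i _ ->] yC /adj_fg [] ey; subst y.
    have [lt_ij|le_ji] := ltnP i.+1 j.
      by apply/imsetP; exists (Ordinal lt_ij).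
    have e : i.+1 = j by apply/eqP; rewrite eqn_leq le_ji ltn_ord.
    by move: yC; rewrite -iterS e (negPf jC).
  case: i => -[|i] lt_ij /= in yC *; first by rewrite yC in gxC.
  by rewrite fK; apply/imsetP; exists (Ordinal (ltnW lt_ij)).
have arcAB i : i < j -> iter i f x \in A :&: B.
  move=> lt_ij; rewrite inE; apply: contraLR lt_ij.
  by rewrite negb_and -leqNgt => /j_min.
have arcA i : i < j -> iter i f x \in A by move/arcAB; rewrite inE => /andP [].
have arcB i : i < j -> iter i f x \in B by move/arcAB; rewrite inE => /andP [].
(* The set left first equals the arc, which lies in the other set; equal sizes then give
   equality. *)
case/orP: j_exit => [jA|jB]; [|apply/esym]; apply/eqP; rewrite eqEcard cAB leqnn andbT.
  by rewrite (arc_eq A) //; apply/subsetP=> _ /imsetP [i _ ->]; apply: arcB.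
by rewrite (arc_eq B) //; apply/subsetP=> _ /imsetP [i _ ->]; apply: arcA.
Qed.

(** A proper connected set is an arc, fixed by its size and its first vertex, the one whose
    predecessor lies outside. So sending a set to its first vertex is injective. *)
Lemma nb_connected_sets_cycle (G : sgraph) (k : nat) :
  connected_graph G -> isomorphic G (cycle_graph #|G|) -> k < #|G| ->
  nb_connected_sets G k <= #|G|.
Proof.
move=> connG /cycle_isomorphic_shift [f [g [fK gK adj_fg]]] k_lt.
have [G_gt0 closedT] := connected_graphP _ connG.
have [x0 _] : exists x, x \in G by apply/card_gt0P.
(* The default [x0] is never taken on a connected set of size [k]: such a set, if stable under [g],
   would be all of [G], but k < |G|. *)
pose start (A : {set G}) := odflt x0 [pick x in A | g x \notin A].
have startP A : connected_set A -> #|A| == k -> (start A \in A) /\ (g (start A) \notin A).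
  move=> cA /eqP cardA; rewrite /start; case: pickP => [x /andP [] //|closed_g].
  have gA x : x \in A -> g x \in A.
    by move=> xA; have := closed_g x; rewrite /= xA /= => /negbFE.
  (* Injectivity and finiteness turn stability under [g] into stability under [f] as well, so [A] is
     closed under adjacency. *)
  have gAE : g @: A = A.
    apply/eqP; rewrite eqEcard card_imset ?leqnn ?andbT; last exact: can_inj gK.
    by apply/subsetP=> _ /imsetP [x xA ->]; apply: gA.
  have AT : A = [set: G].
    apply: closedT; first by case/connected_setP: cA.
    move=> x y xA _ /adj_fg [] ->; last exact: gA.
    by move: xA; rewrite -{1}gAE => /imsetP [a aA ->]; rewrite gK.
  by move: k_lt; rewrite -cardA AT cardsT ltnn.
apply: (@leq_card_in _ _ start) => A B; rewrite !inE.
move=> /andP [cA kA] /andP [cB kB] eAB.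
have [sA gsA] := startP A cA kA; have [sB gsB] := startP B cB kB.
rewrite -eAB in sB gsB.
by apply: (connected_arcs_eq fK gK adj_fg cA cB _ sA sB) => //; rewrite (eqP kA) (eqP kB).
Qed.

(** * Two facts on binomial counting *)

(** Removing [D] maps these sets bijectively to the subsets of size k - |D| of its complement. *)
Lemma card_supersets (T : finType) (D : {set T}) (k : nat) :
  #|D| <= k ->
  #|[set A : {set T} | (D \subset A) && (#|A| == k)]| = 'C(#|T| - #|D|, k - #|D|).
Proof.
move=> le_Dk; have <- : #|~: D| = #|T| - #|D| by rewrite cardsCs setCK.
rewrite -cards_draws.
rewrite -(@card_in_imset _ _ (fun A : {set T} => A :\: D)).
  apply: eq_card => B; rewrite inE; apply/imsetP/andP => [[A + ->]|[BD /eqP cB]].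
    rewrite inE => /andP [DA /eqP cA]; split; first by rewrite setDE subsetIr.
    by rewrite cardsD (setIidPr DA) cA.
  have BD0 : B :&: D = set0 by apply/eqP; rewrite setI_eq0 disjoints_subset.
  exists (B :|: D); last first.
    by rewrite setDUl setDv setU0; apply/esym/setDidPl; rewrite -setI_eq0 BD0.
  by rewrite inE subsetUr cardsU BD0 cards0 subn0 cB subnK /=.
move=> A B; rewrite !inE => /andP [DA _] /andP [DB _] eAB.
by rewrite -(setID A D) -(setID B D) eAB (setIidPr DA) (setIidPr DB).
Qed.

(** Induction on [n] by Pascal's rule. Only k = n - 2 has no bound in the row before; there C(n, k)
    = C(n, 2) by symmetry. *)
Lemma leq_bin_inner (n k : nat) : 4 <= n -> 2 <= k -> k.+2 <= n -> n < 'C(n, k).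
Proof.
elim: n k => // n IHn [|[|k]] // n_ge4 _ k_le.
have : 'C(n.+1, 2) <= 'C(n.+1, k.+2) \/ n < 'C(n, k.+2).
  have [e|lt_kn] : k.+4 = n.+1 \/ k.+4 < n.+1 by lia.
    by left; rewrite -e -(@bin_sub k.+4 2) // subn2.
  by right; apply: IHn => //; lia.
case=> [|lt_n]; last first.
  have bin_pos : 0 < 'C(n, k.+1) by rewrite bin_gt0; lia.
  by rewrite binS; lia.
by apply: leq_trans; rewrite bin2 /= -divn2 leq_divRL //; nia.
Qed.

(** * Leaves of unicyclic graphs *)

Lemma connected_degree_gt0 (G : sgraph) (x : G) :
  connected_graph G -> 1 < #|G| -> 0 < degree x.
Proof.
case/connected_graphP=> _ closedT G_gt1; rewrite card_gt0.
apply: contraTneq G_gt1 => nbr0; rewrite -leqNgt -cardsT -(closedT [set x]).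
- by rewrite cards1.
- by apply/set0Pn; exists x; rewrite inE.
by move=> _ y /set1P -> _; rewrite -in_neighbours nbr0 in_set0.
Qed.

Lemma unicyclic_handshake (G : sgraph) :
  unicyclic G = connected_graph G && (\sum_(x : G) degree x == 2 * #|G|).
Proof. by rewrite /unicyclic handshake eqn_pmul2l // eq_sym. Qed.

(** The average degree is 2. If no degree is below 2, then all equal 2; and a vertex of degree below
    2 has degree 1, as connectivity rules out 0. *)
Lemma unicyclic_leaf (G : sgraph) :
  unicyclic G -> ~~ two_regular G -> exists v w : G, neighbours v = [set w].
Proof.
rewrite unicyclic_handshake => /andP [connG /eqP sum_deg] not_reg.
have [G_gt0 _] := connected_graphP _ connG.
(* A single vertex would give degree sum 0 instead of 2. *)
have G_gt1 : 1 < #|G|.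
  rewrite ltn_neqAle G_gt0 andbT; apply: contra_eqT sum_deg => /negPn/eqP G1.
  rewrite big1 => [|x _]; first by rewrite -G1.
  apply/eqP; rewrite cards_eq0; apply/eqP/setP=> y; rewrite !inE.
  have /fintype_le1P/(_ x y) -> : #|G| <= 1 by rewrite -G1.
  by rewrite adj_irrefl.
have [v dv|deg_ge2] := pickP [pred v : G | degree v < 2].
  have /cards1P [w ew] : degree v == 1.
    by rewrite eqn_leq -ltnS (dv : degree v < 2) connected_degree_gt0.
  by exists v, w.
case/negP: not_reg.
have deg2 (x : G) : true -> 2 <= degree x ?= iff (2 == degree x).
  by move=> _; split=> //; have := deg_ge2 x; rewrite /= ltnNge => /negbFE.
have [_] := leqif_sum deg2.
rewrite sum_nat_const sum_deg mulnC eqxx => /esym/forallP all2.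
by apply/forallP=> x; rewrite eq_sym; apply: all2.
Qed.

(** * Deleting a leaf *)

Definition delete (G : sgraph) (v : G) : sgraph := induced (~: [set v]).

Lemma card_delete (G : sgraph) (v : G) : #|delete v| = #|G|.-1.
Proof.
rewrite card_sig (_ : #|_| = #|~: [set v]|); last exact: eq_card.
by rewrite cardsC1.
Qed.

Lemma degree_delete (G : sgraph) (v : G) (x : delete v) :
  degree (val x) = adj (val x) v + degree x.
Proof.
rewrite /degree (cardsD1 v) in_neighbours; congr (_ + _).
rewrite -(card_imset _ val_inj); apply: eq_card => y; rewrite !inE.
apply/andP/imsetP => [[yv xy]|[z xz ->]].
  have yA : y \in ~: [set v] by rewrite !inE.
  by exists (Sub y yA) => //; rewrite inE.
by rewrite inE in xz; split=> //; have := valP z; rewrite !inE.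
Qed.

Lemma leaf_neq (G : sgraph) (v w : G) : neighbours v = [set w] -> v != w.
Proof.
move=> nv; have : adj v w by rewrite -in_neighbours nv set11.
by apply: contraTneq => ->; rewrite adj_irrefl.
Qed.

(** A closed set [S] of [delete v] extends to a closed set [S'] of [G] by adding [v] exactly when
    [w] is in [S]. *)
Lemma connected_delete_leaf (G : sgraph) (v w : G) :
  neighbours v = [set w] -> connected_graph G -> connected_graph (delete v).
Proof.
move=> nv; rewrite connected_setT => /connected_setP [_ closedT].
have vw := leaf_neq nv.
apply/connected_setP; split=> [|S SA S_n0 Scl].
  by apply/set0Pn; exists w; rewrite !inE eq_sym.
have vS : v \notin S by apply/negP=> /(subsetP SA); rewrite !inE eqxx.
have adjv x : adj x v = (x == w) by rewrite adj_sym -in_neighbours nv inE.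
pose S' := if w \in S then v |: S else S.
have S'E x : x != v -> (x \in S') = (x \in S).
  by rewrite /S'; case: ifP => // _ /negPf xv; rewrite !inE xv.
have S'T : S' = [set: G].
  apply: closedT; first exact: subsetT.
    case/set0Pn: S_n0 => x xS; apply/set0Pn; exists x.
    by rewrite S'E //; apply: contraNneq vS => <-.
  move=> x y xS' _ xy; have [eyv|yv] := eqVneq y v.
    move: xy; rewrite eyv adjv => /eqP exw; rewrite exw S'E 1?eq_sym // in xS'.
    by rewrite /S' xS' !inE eqxx.
  rewrite S'E //; have [exv|xv] := eqVneq x v.
    move: xy xS'; rewrite exv adj_sym -{1}exv adj_sym exv -in_neighbours nv inE => /eqP ->.
    by rewrite /S'; case: ifP => //; rewrite (negPf vS).
  by apply: (Scl x) => //; rewrite -?S'E // !inE.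
apply/eqP; rewrite eqEsubset SA; apply/subsetP=> x; rewrite !inE => xv.
by rewrite -S'E // S'T inE.
Qed.

(** The degree sum drops by 2, once for the degree of [v] and once for the neighbour that [w] loses,
    while the order drops by 1. *)
Lemma unicyclic_delete_leaf (G : sgraph) (v w : G) :
  neighbours v = [set w] -> unicyclic G -> unicyclic (delete v).
Proof.
move=> nv; rewrite !unicyclic_handshake => /andP [connG /eqP sum_deg].
rewrite (connected_delete_leaf nv connG) /= card_delete.
have deg_v : degree v = 1 by rewrite /degree nv cards1.
have : \sum_(x : G) degree x = (1 + \sum_(x : delete v) degree (val x)).
  rewrite (bigD1 v) //= deg_v; congr (_ + _).
  rewrite -(big_sub (mem (~: [set v])) (@degree G)).
  by apply: eq_bigl => x; rewrite !inE.
under [in RHS]eq_bigr do rewrite degree_delete.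
rewrite big_split /= sum_deg.
have -> : \sum_(x : delete v) adj (val x) v = 1.
  rewrite -(big_sub (mem (~: [set v])) (fun x => adj x v : nat)).
  rewrite (bigD1 w) ?inE 1?eq_sym ?(leaf_neq nv) //= adj_sym -in_neighbours nv set11 big1 // => x.
  by case/andP=> _ /negPf xw; rewrite adj_sym -in_neighbours nv inE xw.
have : 0 < #|G| by apply/card_gt0P; exists v.
by case: #|G| => // m _ e; apply/eqP; move: e; rewrite /=; lia.
Qed.

(** * Connected sets avoiding or containing the deleted vertex *)

Lemma imset_val_preim_delete (G : sgraph) (v : G) (A : {set G}) :
  v \notin A -> val @: [set x : delete v | val x \in A] = A.
Proof.
move=> vA; apply/setP=> x; apply/imsetP/idP => [[y + ->]|xA]; first by rewrite inE.
have xv : x \in ~: [set v] by rewrite !inE; apply: contraNneq vA => <-.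
by exists (Sub x xv); rewrite ?inE.
Qed.

Lemma connected_set_delete (G : sgraph) (v : G) (A : {set G}) :
  v \notin A -> connected_set A -> connected_set [set x : delete v | val x \in A].
Proof.
move=> vA /connected_setP [A_n0 closedT]; have eA := imset_val_preim_delete vA.
apply/connected_setP; split=> [|S SA S_n0 Scl].
  by rewrite -(imset_eq0 val) eA.
apply: (imset_inj val_inj); rewrite eA; apply: closedT.
- by rewrite -eA imsetS.
- by rewrite imset_eq0.
move=> _ y /imsetP [x xS ->]; rewrite -{1}eA => /imsetP [z zA ->] xz.
by apply/imset_f/(Scl x).
Qed.

(** The connected sets avoiding [v] stay connected in [delete v], and reading them there is
    injective. *)
Lemma nb_connected_sets_delete (G : sgraph) (v : G) (k : nat) :
  nb_connected_sets G k <= nb_connected_sets (delete v) k +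
    #|[set A : {set G} | [&& connected_set A, #|A| == k & v \in A]]|.
Proof.
rewrite /nb_connected_sets.
set X := [set A | _ & _]; set Y := [set A | [&& _, _ & _]].
have -> : #|X| = #|X :\: Y| + #|Y|.
  rewrite -(cardsID Y X) addnC; congr (_ + _); apply: eq_card => A.
  by rewrite !inE; case: (connected_set A); case: (#|A| == k); rewrite ?andbF.
rewrite leq_add2r -(@card_in_imset _ _ (fun A : {set G} => [set x : delete v | val x \in A])).
  apply/subset_leq_card/subsetP=> _ /imsetP [A + ->]; rewrite !inE.
  case: (connected_set A) / idP => //= cA; case: eqP => //= kA.
  rewrite andbT => vA; rewrite connected_set_delete // -(card_imset _ val_inj).
  by rewrite imset_val_preim_delete ?kA /=.
move=> A B; rewrite !inE.
case: (connected_set A) / idP => //= _; case: (#|A| =P k) => //= _.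
case: (connected_set B) / idP => //= _; case: (#|B| =P k) => //= _.
rewrite !andbT => vA vB eAB.
by rewrite -(imset_val_preim_delete vA) eAB imset_val_preim_delete.
Qed.

(** Without [w], the set {v} would be closed in [A], forcing A = {v}. *)
Lemma connected_mem_neighbour (G : sgraph) (v w : G) (A : {set G}) :
  neighbours v = [set w] -> connected_set A -> 1 < #|A| -> v \in A -> w \in A.
Proof.
move=> nv /connected_setP [_ closedT] A_gt1 vA; apply: contraTT A_gt1 => wA.
rewrite -leqNgt -(closedT [set v]) ?cards1 //; first by rewrite sub1set.
  by apply/set0Pn; exists v; rewrite inE.
by move=> _ y /set1P -> yA; rewrite -in_neighbours nv inE => /eqP e; rewrite -e yA in wA.
Qed.

Lemma connected_sets_leaf_subset (G : sgraph) (v w : G) (k : nat) :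
  neighbours v = [set w] -> 1 < k ->
  [set A : {set G} | [&& connected_set A, #|A| == k & v \in A]]
    \subset [set A : {set G} | ([set v; w] \subset A) && (#|A| == k)].
Proof.
move=> nv k_gt1; apply/subsetP=> A; rewrite !inE => /and3P [cA kA vA].
rewrite kA andbT subUset !sub1set vA /=.
by apply: (connected_mem_neighbour nv) => //; rewrite (eqP kA).
Qed.

(* Removing the two neighbours of [w] other than the leaf [v] isolates the pair
   [v], [w]. *)
Lemma disconnected_superset (G : sgraph) (v w : G) :
  neighbours v = [set w] -> degree w = 3 -> 4 < #|G| ->
  exists A : {set G},
    [/\ [set v; w] \subset A, #|A| = #|G|.-2 & ~~ connected_set A].
Proof.
move=> nv deg_w G_gt4; pose D := neighbours w :\ v.
have wv : v \in neighbours w by rewrite in_neighbours adj_sym -in_neighbours nv inE.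
have cardD : #|D| = 2.
  by have := cardsD1 v (neighbours w); rewrite wv -/(degree w) deg_w add1n => -[<-].
have cardA : #|~: D| = #|G|.-2 by rewrite cardsCs setCK cardD subn2.
have vwA : [set v; w] \subset ~: D.
  by rewrite subUset !sub1set !inE eqxx adj_irrefl andbF.
exists (~: D); split=> //; apply/negP=> /connected_setP [_ closedT].
have : #|[set v; w]| = #|~: D|.
  rewrite (closedT [set v; w]) //; first by apply/set0Pn; exists v; rewrite !inE eqxx.
  move=> x y; rewrite !inE => /orP [] /eqP -> yD xy.
    by move: xy; rewrite -in_neighbours nv inE => ->; rewrite orbT.
  by move: yD; rewrite xy andbT negbK => ->.
by rewrite cardA cards2; case: (v != w); lia.
Qed.

(** * The upper bound for unicyclic graphs *)

(** Cycles are included because deleting leaves may end in one. The exception is genuine: a cycle of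
    order m > 3 has m connected sets of size m - 1, while C(m - 1, m - 2) = m - 1. *)
Lemma connected_sets_unicyclic (G : sgraph) (k : nat) :
  unicyclic G -> 2 < k -> ~~ (two_regular G && (k.+1 == #|G|)) ->
  nb_connected_sets G k <= 'C(#|G|.-1, k.-1).
Proof.
move: {2}#|G| (erefl #|G|) => n; elim: n G k => [|n IHn] G k cardG uniG k_gt2.
  by move: uniG; rewrite /unicyclic /connected_graph cardG.
have connG : connected_graph G by case/andP: uniG.
have [reg|not_reg] := boolP (two_regular G) => [/= k_ne|_].
  have le_draws : nb_connected_sets G k <= 'C(#|G|, k).
    rewrite -card_draws; apply/subset_leq_card/subsetP=> A.
    by rewrite !inE => /andP [].
  have [lt_k|le_k] := ltnP k #|G|.
    have iso := two_regular_isomorphic_cycle connG reg.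
    apply: leq_trans (nb_connected_sets_cycle connG iso lt_k) _.
    by rewrite cardG /=; apply: leq_bin_inner; move: k_ne lt_k; rewrite cardG; lia.
  (* For k >= |G| at most the whole vertex set is counted. *)
  apply: leq_trans le_draws _; move: le_k; rewrite leq_eqVlt => /orP [/eqP <-|lt_k].
    by rewrite cardG /= !binn.
  by rewrite bin_small.
have [v [w nv]] := unicyclic_leaf uniG not_reg.
have vw := leaf_neq nv.
have card_vw : #|[set v; w]| = 2 by rewrite cards2 vw.
have le_2k : #|[set v; w]| <= k by rewrite card_vw; lia.
have n_gt0 : 0 < n.
  by have := max_card (mem [set v; w]); rewrite card_vw cardG; lia.
have cardH : #|delete v| = n by rewrite card_delete cardG.
have uniH := unicyclic_delete_leaf nv uniG.
have connH : connected_graph (delete v) by case/andP: uniH.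
have leaf_sub := connected_sets_leaf_subset nv (ltnW k_gt2).
have card_sup := card_supersets le_2k.
rewrite card_vw cardG subSS in card_sup.
(* Pascal's rule splits the bound into a share for the sets avoiding [v] and one for those
   containing [v] and [w]. Here |G| = n + 1. *)
have binE : 'C(#|G|.-1, k.-1) = 'C(n.-1, k.-1) + 'C(n - 1, k - 2).
  rewrite cardG subn1; case: (n) n_gt0 => // n' _.
  by case: (k) k_gt2 => [|[|k']] //= _; rewrite binS subSS subn1.
apply: leq_trans (nb_connected_sets_delete v k) _; rewrite binE.
have [/andP [regH /eqP k_eq]|not_ex] := boolP (two_regular (delete v) && (k.+1 == #|delete v|)).
  rewrite cardH in k_eq.
  have isoH := two_regular_isomorphic_cycle connH regH.
  have lt_kH : k < #|delete v| by rewrite cardH -k_eq.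
  have := nb_connected_sets_cycle connH isoH lt_kH; rewrite cardH => le_cycle.
  (* The share of the sets avoiding [v] is k, but the cycle bound only gives n = k + 1. *)
  have binH : 'C(n.-1, k.-1) = k.
    by rewrite -k_eq /= -[k.-1]subn1 bin_sub ?bin1 // ltnW // ltnW.
  have wA : w \in ~: [set v] by rewrite !inE eq_sym.
  have deg_w : degree w = 3.
    rewrite (degree_delete (Sub w wA)) /= adj_sym -in_neighbours nv set11.
    by rewrite (eqP (forallP regH _)).
  (* The order of [G] is k + 2, so it exceeds 4 and [B] has size exactly k. *)
  have [|B [vwB cardB B_conn]] := disconnected_superset nv deg_w;
    first by rewrite cardG -k_eq !ltnS.
  rewrite cardG -k_eq /= in cardB.
  (* The disconnected [B] makes the inclusion strict, which makes up for the excess of one. *)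
  have : [set A : {set G} | [&& connected_set A, #|A| == k & v \in A]] \proper
         [set A : {set G} | ([set v; w] \subset A) && (#|A| == k)].
    rewrite properE leaf_sub; apply/subsetPn; exists B.
      by rewrite inE vwB cardB eqxx.
    by rewrite inE negb_and B_conn.
  rewrite -k_eq in le_cycle; move/proper_card; rewrite card_sup binH => lt_sup.
  apply: leq_trans (leq_add le_cycle (leqnn _)) _.
  by rewrite addSnnS leq_add2l.
have := IHn _ k cardH uniH k_gt2 not_ex; rewrite cardH => le_H.
by apply: leq_add le_H _; rewrite -card_sup; apply: subset_leq_card.
Qed.

(** * Coefficients of [CS] and connected sets of size at most 2 *)

Lemma connected_set_n0 (G : sgraph) (A : {set G}) : connected_set A -> A != set0.
Proof. by case/connected_setP. Qed.

Lemma nb_connected_sets0 (G : sgraph) : nb_connected_sets G 0 = 0.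
Proof.
apply/eqP; rewrite cards_eq0; apply/eqP/setP=> A; rewrite !inE cards_eq0.
by apply/negP=> /andP [/connected_set_n0 /negPf ->].
Qed.

Lemma nb_connected_sets_gt (G : sgraph) (k : nat) :
  #|G| < k -> nb_connected_sets G k = 0.
Proof.
move=> lt_k; apply/eqP; rewrite cards_eq0; apply/eqP/setP=> A; rewrite !inE.
by apply/negP=> /andP [_ /eqP kA]; have := max_card (mem A); rewrite kA; lia.
Qed.

(** Outside the range of the sum both sides vanish: the empty set is not connected, and no set
    exceeds |G| in size. *)
Lemma coef_CS (G : sgraph) (k : nat) :
  ((CS G)`_k = (nb_connected_sets G k)%:R)%R.
Proof.
rewrite /CS coef_sum; have [k_ok|k_bad] := boolP (0 < k < #|G|.+1).
  rewrite (bigD1_seq k) ?mem_index_iota ?iota_uniq //=.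
  rewrite coefZ coefXn eqxx mulr1 big1 ?addr0 // => i /negPf ne.
  by rewrite coefZ coefXn eq_sym ne mulr0.
rewrite big_seq big1 => [|i]; last first.
  rewrite mem_index_iota coefZ coefXn => i_ok; case: eqP => [e|_]; last by rewrite mulr0.
  by rewrite e i_ok in k_bad.
case: k k_bad => [|k] k_bad; first by rewrite nb_connected_sets0.
by rewrite nb_connected_sets_gt //; lia.
Qed.

Lemma connected_set1 (G : sgraph) (x : G) : connected_set [set x].
Proof.
apply/connected_setP; split=> [|S]; first by apply/set0Pn; exists x; rewrite inE.
by rewrite subset1 => /orP [/eqP -> //|/eqP ->]; rewrite eqxx.
Qed.

Lemma connected_set2 (G : sgraph) (A : {set G}) :
  #|A| = 2 -> connected_set A = (A \in edges G).
Proof.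
move/eqP/cards2P=> [a [b [ab ->]]]; apply/idP/imsetP => [|[[x y] /= xy ->]].
  case/connected_setP=> _ closedT; case adj_ab: (adj a b); first by exists (a, b); rewrite ?inE.
  have /setP/(_ b) : [set a] = [set a; b].
    apply: closedT; rewrite ?subsetUl //; first by apply/set0Pn; exists a; rewrite inE.
    move=> _ y /set1P ->; rewrite !inE => /orP [] // /eqP ->.
    by rewrite adj_ab.
  by rewrite !inE eqxx orbT eq_sym (negPf ab).
rewrite inE /= in xy.
apply/connected_setP; split=> [|S SA /set0Pn [z zS] Scl].
  by apply/set0Pn; exists x; rewrite !inE eqxx.
have [xA yA] : x \in [set x; y] /\ y \in [set x; y] by rewrite !inE !eqxx orbT.
have := subsetP SA z zS; rewrite !inE => ez.
have [xS yS] : x \in S /\ y \in S.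
  case/orP: ez => /eqP ez; subst z; split=> //; first exact: Scl zS yA xy.
  by apply: Scl zS xA _; rewrite adj_sym.
by apply/eqP; rewrite eqEsubset SA subUset !sub1set xS yS.
Qed.

Lemma nb_connected_sets1 (G : sgraph) : nb_connected_sets G 1 = #|G|.
Proof.
rewrite -[RHS]bin1 -card_draws; apply: eq_card => A; rewrite !inE.
by apply: andb_idl => /cards1P [x ->]; apply: connected_set1.
Qed.

Lemma nb_connected_sets2 (G : sgraph) : nb_connected_sets G 2 = #|edges G|.
Proof.
apply: eq_card => A; rewrite inE; case: eqP => [cA|ncA].
  by rewrite andbT connected_set2.
rewrite andbF; apply/esym/negP=> /imsetP [[x y]]; rewrite inE /= => xy eA.
case: ncA; rewrite eA cards2; case: eqVneq xy => // ->; by rewrite adj_irrefl.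
Qed.

(** * The lower bound for [U n] *)

(** A nonempty closed part of [A] first catches [c], then every vertex of [A]. *)
Lemma dominating_connected_set (G : sgraph) (c : G) (A : {set G}) :
  (forall x, x != c -> adj c x) -> c \in A -> connected_set A.
Proof.
move=> c_adj cA; apply/connected_setP; split=> [|S SA /set0Pn [z zS] Scl].
  by apply/set0Pn; exists c.
have cS : c \in S.
  have [<-//|zc] := eqVneq z c.
  by apply: Scl zS cA _; rewrite adj_sym c_adj.
apply/eqP; rewrite eqEsubset SA; apply/subsetP=> x xA.
by have [->//|xc] := eqVneq x c; apply: Scl cS xA _; apply: c_adj.
Qed.

Lemma dominating_connected_sets_subset (G : sgraph) (c : G) (k : nat) :
  (forall x, x != c -> adj c x) ->
  [set A : {set G} | ([set c] \subset A) && (#|A| == k)]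
    \subset [set A : {set G} | connected_set A & #|A| == k].
Proof.
move=> c_adj; apply/subsetP=> A; rewrite !inE sub1set => /andP [cA ->].
by rewrite andbT; apply: dominating_connected_set cA.
Qed.

Definition center_U (n : nat) : U n := inr ord0.

Lemma card_U (n : nat) : 2 < n -> #|U n| = n.
Proof. by move=> n_gt2; rewrite /= !card_sum !card_ord; lia. Qed.

Lemma center_U_dominating (n : nat) (x : U n) :
  x != center_U n -> adj (center_U n) x.
Proof. by case: x => // x; rewrite (ord1 x) eqxx. Qed.

Lemma nb_connected_sets_U (n k : nat) :
  2 < n -> 0 < k -> 'C(n.-1, k.-1) <= nb_connected_sets (U n) k.
Proof.
move=> n_gt2 k_gt0.
rewrite -!subn1 -{1}(card_U n_gt2) -(cards1 (center_U n)) -card_supersets ?cards1 //.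
exact/subset_leq_card/dominating_connected_sets_subset/center_U_dominating.
Qed.

(* The pairs containing the centre give n-1 edges, the edge [a b] is one more. *)
Lemma nb_connected_sets2_U (n : nat) : 2 < n -> n <= nb_connected_sets (U n) 2.
Proof.
move=> n_gt2; pose c := center_U n.
pose a : U n := inl (inl ord0); pose b : U n := inl (inl ord_max).
have card_sup : #|[set A : {set U n} | ([set c] \subset A) && (#|A| == 2)]| = n.-1.
  by rewrite card_supersets cards1 // card_U // subn1 bin1.
apply: leq_trans (leqSpred n) _; rewrite -card_sup.
apply: proper_card; rewrite properE.
rewrite dominating_connected_sets_subset; last exact: center_U_dominating.
apply/subsetPn; exists [set a; b]; last by rewrite !inE sub1set !inE.
have c2 : #|[set a; b]| = 2 by rewrite cards2.
rewrite inE c2 eqxx andbT connected_set2 //.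
by apply/imsetP; exists (a, b); rewrite ?inE.
Qed.

(** * Comparison of the two polynomials *)

Theorem theorem3p4 (n : nat) (G : sgraph) (n_ge5 : 5 <= n)
    (order_G : #|G| = n) (unicyclic_G : unicyclic G)
    (not_cycle : ~ isomorphic G (cycle_graph n)) :
  poly_preceq (CS G) (CS (U n)).
Proof.
have n_gt2 : 2 < n by lia.
have connG : connected_graph G by case/andP: unicyclic_G.
have not_reg : ~~ two_regular G.
  by apply/negP=> reg; apply: not_cycle; rewrite -order_G; apply: two_regular_isomorphic_cycle.
have le_nb k : nb_connected_sets G k <= nb_connected_sets (U n) k.
  case: k => [|[|[|k]]].
  - by rewrite nb_connected_sets0.
  - by rewrite !nb_connected_sets1 order_G card_U.
  (* For pairs the binomial lower bound n - 1 is too small; the n edges of [G] are compared with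
     those of [U n]. *)
  - rewrite nb_connected_sets2; case/andP: unicyclic_G => _ /eqP <-.
    by rewrite order_G nb_connected_sets2_U.
  - apply: leq_trans (nb_connected_sets_U n_gt2 _) => //.
    by rewrite -order_G; apply: connected_sets_unicyclic; rewrite ?negb_and ?not_reg.
split=> [|k]; last by rewrite !coef_CS ler_nat.
(* Degrees compare because a vanishing coefficient of [CS (U n)] forces that of [CS G] to vanish, by
   [le_nb]. *)
apply/leq_sizeP=> j /leq_sizeP/(_ j (leqnn j)).
rewrite !coef_CS => /eqP; rewrite pnatr_eq0 => /eqP U0.
by have := le_nb j; rewrite U0 leqn0 => /eqP ->.
Qed.
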